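(* There exists an isomorphism of topological rings $\overline{\mathbb{Q}}\cong\mathbb{A}_f$ which preserves the inclusion of $\mathbb{Q}$ in both rings (that is, it carries the canonical image of each rational number $q$ in the completion $\overline{\mathbb{Q}}$ to the diagonal image of $q$ in $\mathbb{A}_f$). Here $\overline{\mathbb{Q}}$ denotes the completion of $\mathbb{Q}$ with respect to the finite adelic topology (not an algebraic closure), and $\mathbb{A}_f$ is the finite adèle ring of $\mathbb{Q}$.
   Context: For integers $N\ge 1$ consider $\mathrm{lcm}(1,\dots,N)$, and let $1=m_0<m_1<m_2<\cdots$ be the increasing enumeration of the distinct values taken by this function ($1,2,6,12,60,420,\dots$). Set $e^{\psi(n)}=m_n$ for $n\ge 0$ and $e^{\psi(n)}=1/m_{-n}$ for $n<0$. The additive subgroups $e^{\psi(n)}\mathbb{Z}$, $n\in\mathbb{Z}$, of $\mathbb{Q}$ form a decreasing chain with intersection $\{0\}$ and union $\mathbb{Q}$; they are a neighbourhood base of zero for an additively invariant Hausdorff topology on $\mathbb{Q}$, called the finite adelic topology. A sequence $(a_n)$ of rationals is Cauchy if for all $k\in\mathbb{Z}$ one has $a_n-a_m\in e^{\psi(k)}\mathbb{Z}$ for all $n,m$ sufficiently large, and it is trivial if for all $k\in\mathbb{Z}$ one has $a_n\in e^{\psi(k)}\mathbb{Z}$ for all $n$ sufficiently large. The Cauchy sequences form a commutative ring $\mathcal{C}(\mathbb{Q})$ under componentwise operations, the trivial ones an ideal $\mathcal{C}_0(\mathbb{Q})$, and $\overline{\mathbb{Q}}=\mathcal{C}(\mathbb{Q})/\mathcal{C}_0(\mathbb{Q})$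 with the completion topology; $\mathbb{Q}$ embeds densely by constant sequences. The finite adèle ring is $\mathbb{A}_f=\{(x_p)_p\in\prod_p\mathbb{Q}_p : x_p\in\mathbb{Z}_p \text{ for all but finitely many primes } p\}$, with the restricted direct product topology, i.e. the additively invariant topology having as neighbourhood base of zero the subgroups $q\prod_p\mathbb{Z}_p$, $q\in\mathbb{Q}$, $q\ne 0$; $\mathbb{Q}$ is included in $\mathbb{A}_f$ diagonally. *)

(* Defs.v *)
From HB Require Import structures.
From mathcomp Require Import all_boot all_order all_algebra.
From mathcomp Require Import generic_quotient ring_quotient ring.
From mathcomp Require Import all_classical topology tvs.

Set Implicit Arguments.
Unset Strict Implicit.
Unset Printing Implicit Defensive.

Import Order.TTheory GRing.Theory Num.Theory.

Local Open Scope classical_set_scope.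
Local Open Scope quotient_scope.
Local Open Scope ring_scope.

(* A filter base of additive subgroups defining a Hausdorff ring topology on R
   (as a fundamental system of neighbourhoods of 0). *)
Record ringBase (I : Type) (R : comNzRingType) := RingBase {
  rb_set :> I -> set R;
  rb_inh : inhabited I;
  rb0 : forall i, rb_set i 0;
  rbB : forall i x y, rb_set i x -> rb_set i y -> rb_set i (x - y);
  rbI : forall i j, exists k, rb_set k `<=` rb_set i `&` rb_set j;
  rbZ : forall x i, exists j, forall y, rb_set j y -> rb_set i (x * y);
  rbM : forall i, exists j, forall x y,
    rb_set j x -> rb_set j y -> rb_set i (x * y);
  rb_sep : forall x, (forall i, rb_set i x) -> x = 0
}.

Section RingBaseTopology.
Variables (I : Type) (R : comNzRingType) (B : ringBase I R).

Definition rb_nbhs (x : R) : set_system R :=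
  filter_from setT (fun i => [set y | B i (y - x)]).

Lemma rbN i x : B i x -> B i (- x).
Proof. by move=> Bx; rewrite -sub0r; apply: rbB => //; exact: rb0. Qed.

Lemma rbD i x y : B i x -> B i y -> B i (x + y).
Proof. by move=> Bx By; rewrite -[y]opprK; apply: rbB => //; exact: rbN. Qed.

Lemma rb_nbhs_filter x : ProperFilter (rb_nbhs x).
Proof.
apply: filter_from_proper; last first.
  by move=> i _; exists x; rewrite /= subrr; exact: rb0.
apply: filter_from_filter; first by case: (rb_inh B) => i; exists i.
move=> i j _ _; have [k kij] := rbI B i j.
by exists k => // y By; have [] := kij _ By.
Qed.

Lemma rb_nbhs_singleton x A : rb_nbhs x A -> A x.
Proof. by case=> i _; apply; rewrite /= subrr; exact: rb0. Qed.

Lemma rb_nbhs_nbhs x A : rb_nbhs x A -> rb_nbhs x (rb_nbhs^~ A).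
Proof.
case=> i _ iA; exists i => // y By; exists i => // z Bz; apply: iA => /=.
by rewrite -(subrK y z) -addrA; exact: rbD.
Qed.

Lemma rb_nbhs_sub x y A : rb_nbhs (x - y) A ->
  exists2 i, True & forall u v, B i (u - x) -> B i (v - y) -> A (u - v).
Proof.
case=> i _ iA; exists i => // u v Bu Bv; apply: iA => /=.
by rewrite opprD addrACA -opprD; exact: rbB.
Qed.

Lemma rb_nbhs_mul x y A : rb_nbhs (x * y) A ->
  exists2 i, True & forall u v, B i (u - x) -> B i (v - y) -> A (u * v).
Proof.
case=> i _ iA; have [j1 j1P] := rbZ B x i; have [j2 j2P] := rbZ B y i.
have [j3 j3P] := rbM B i.
have [k kP] := rbI B j1 j2; have [l lP] := rbI B k j3.
exists l => // u v /lP [/kP [_ Bu2] Bu3] /lP [/kP [Bv1 _] Bv3].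
apply: iA => /=.
have -> : u * v - x * y = (u - x) * (v - y) + (y * (u - x) + x * (v - y)).
  by ring.
apply: rbD; first exact: j3P.
by apply: rbD; [exact: j2P|exact: j1P].
Qed.

End RingBaseTopology.

(* Completion of R: the ring of Cauchy sequences modulo the ideal of trivial
   sequences. *)
Section Completion.
Variables (I : Type) (R : comNzRingType) (B : ringBase I R).

Definition cauchy : {pred nat -> R} := fun a => `[< forall i, exists N,
  forall n m, (N <= n)%N -> (N <= m)%N -> B i (a n - a m) >].

Definition eventually_in (a : nat -> R) (U : set R) :=
  exists N, forall n, (N <= n)%N -> U (a n).

Lemma cauchyP a : reflect (forall i, exists N,
  forall n m, (N <= n)%N -> (N <= m)%N -> B i (a n - a m)) (a \in cauchy).
Proof. exact: asboolP. Qed.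

Lemma cauchy_bound a i : a \in cauchy ->
  exists x, eventually_in a [set y | B i (y - x)].
Proof. by move=> /cauchyP/(_ i)[N NP]; exists (a N), N => n Nn; exact: NP. Qed.

Lemma eventually_inI a b U V : eventually_in a U -> eventually_in b V ->
  exists N, forall n, (N <= n)%N -> U (a n) /\ V (b n).
Proof.
move=> [N NP] [M MP]; exists (maxn N M) => n; rewrite geq_max => /andP[Nn Mn].
by split; [exact: NP|exact: MP].
Qed.

Lemma eventually_in_nonempty a U : eventually_in a U -> exists x, U x.
Proof. by move=> [N NP]; exists (a N); exact: NP. Qed.

Lemma cauchy_subring_closed : subring_closed cauchy.
Proof.
split.
- apply/cauchyP => i; exists 0%N => n m _ _.
  by rewrite [_ - _]subrr; exact: rb0.
- move=> a b /cauchyP ca /cauchyP cb; apply/cauchyP => i.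
  have [N NP] := ca i; have [M MP] := cb i.
  exists (maxn N M) => n m; rewrite !geq_max => /andP[Nn Mn] /andP[Nm Mm].
  have -> : (a - b) n - (a - b) m = (a n - a m) - (b n - b m).
    rewrite [(a - b) n]/(a n - b n) [(a - b) m]/(a m - b m).
    by rewrite !opprD addrACA.
  by apply: rbB; [exact: NP|exact: MP].
- move=> a b ha hb; apply/cauchyP => i.
  have [k kP] := rbM B i.
  have [x xP] := cauchy_bound k ha; have [y yP] := cauchy_bound k hb.
  have [i1 i1P] := rbZ B x i; have [i2 i2P] := rbZ B y i.
  have [j1 j1P] := rbI B i1 i2; have [j jP] := rbI B j1 k.
  have [N NP] := cauchyP _ ha j; have [M MP] := cauchyP _ hb j.
  have [L LP] := eventually_inI xP yP.
  exists (maxn L (maxn N M)) => n m; rewrite !geq_max.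
  move=> /and3P[Ln Nn Mn] /and3P[Lm Nm Mm].
  have [/j1P[_ da2] da] := jP _ (NP _ _ Nn Nm).
  have [/j1P[db1 _] db] := jP _ (MP _ _ Mn Mm).
  have [an _] := LP _ Ln; have [_ bm] := LP _ Lm.
  have -> : (a * b) n - (a * b) m =
     x * (b n - b m) + (a n - x) * (b n - b m) +
     (y * (a n - a m) + (a n - a m) * (b m - y)).
    by change (a n * b n - a m * b m = x * (b n - b m) +
      (a n - x) * (b n - b m) + (y * (a n - a m) + (a n - a m) * (b m - y)));
    ring.
  apply: rbD; apply: rbD.
  + exact: i1P.
  + exact: kP.
  + exact: i2P.
  + exact: kP.
Qed.

HB.instance Definition _ :=
  GRing.isSubringClosed.Build (nat -> R) cauchy cauchy_subring_closed.

Record cauchy_seq := CauchySeq {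
  cauchy_fun :> nat -> R; _ : cauchy_fun \in cauchy }.

HB.instance Definition _ := [isSub for cauchy_fun].
HB.instance Definition _ := [Choice of cauchy_seq by <:].
HB.instance Definition _ := [SubChoice_isSubComNzRing of cauchy_seq by <:].

Lemma cauchy_seqBE (a b : cauchy_seq) n : (a - b) n = a n - b n.
Proof. by []. Qed.

Lemma cauchy_seqDE (a b : cauchy_seq) n : (a + b) n = a n + b n.
Proof. by []. Qed.

Lemma cauchy_seqME (a b : cauchy_seq) n : (a * b) n = a n * b n.
Proof. by []. Qed.

Lemma cauchy_seq_cauchy (a : cauchy_seq) : (a : nat -> R) \in cauchy.
Proof. by case: a. Qed.

Definition trivial_seq : {pred cauchy_seq} :=
  fun a => `[< forall i, eventually_in a (B i) >].

Lemma trivial_seqP (a : cauchy_seq) :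
  reflect (forall i, eventually_in a (B i)) (a \in trivial_seq).
Proof. exact: asboolP. Qed.

Lemma trivial_seq_idealr : idealr_closed trivial_seq.
Proof.
split.
- by apply/trivial_seqP => i; exists 0%N => n _; exact: rb0.
- apply/negP => /trivial_seqP h.
  have /eqP := oner_neq0 R; apply; apply: (rb_sep (r := B)) => i.
  by have [N NP] := h i; exact: (NP N).
- move=> c a b /trivial_seqP ha /trivial_seqP hb; apply/trivial_seqP => i.
  have [k kP] := rbM B i.
  have [x xP] := cauchy_bound k (cauchy_seq_cauchy c).
  have [i1 i1P] := rbZ B x i; have [j jP] := rbI B i1 k.
  have [N NP] := eventually_inI xP (ha j).
  have [M MP] := hb i.
  exists (maxn N M) => n; rewrite geq_max => /andP[Nn Mn].
  have [cn /jP[an1 ank]] := NP _ Nn.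
  rewrite cauchy_seqDE cauchy_seqME; apply: rbD; last exact: MP.
  rewrite -(subrK x (c n)) mulrDl; apply: rbD; last exact: i1P.
  exact: kP.
Qed.

HB.instance Definition _ :=
  isIdealr.Build cauchy_seq trivial_seq trivial_seq_idealr.

Definition completion := {ideal_quot trivial_seq}.

HB.instance Definition _ := GRing.ComNzRing.on completion.

Definition class_of (a : cauchy_seq) : completion := \pi a.

Lemma class_of_eq (a b : cauchy_seq) :
  class_of a = class_of b <-> forall i, eventually_in (a - b) (B i).
Proof.
split=> [/eqmodP|h].
  by rewrite /= Quotient.equivE => /trivial_seqP.
by apply/eqmodP; rewrite /= Quotient.equivE; apply/trivial_seqP.
Qed.

Lemma class_ofB : {morph class_of : a b / a - b}.
Proof. by move=> a b; rewrite /class_of rmorphB. Qed.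

Lemma class_ofM : {morph class_of : a b / a * b}.
Proof. by move=> a b; rewrite /class_of rmorphM. Qed.

Lemma class_of_surj x : exists a, class_of a = x.
Proof. by exists (repr x); rewrite /class_of reprK. Qed.

Lemma cst_cauchy (q : R) : (fun _ : nat => q) \in cauchy.
Proof.
by apply/cauchyP => i; exists 0%N => n m _ _; rewrite subrr; exact: rb0.
Qed.

Definition to_completion (q : R) : completion :=
  class_of (CauchySeq (cst_cauchy q)).

Lemma to_completion_is_zmod_morphism : zmod_morphism to_completion.
Proof.
by move=> x y; rewrite /to_completion -class_ofB; congr class_of; apply: val_inj.
Qed.

Lemma to_completion_is_monoid_morphism : monoid_morphism to_completion.
Proof.
split; first by rewrite /to_completion /class_of -(rmorph1 \pi_completion);
  congr (\pi _); apply: val_inj.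
by move=> x y; rewrite /to_completion -class_ofM; congr class_of; apply: val_inj.
Qed.

HB.instance Definition _ := GRing.isZmodMorphism.Build R completion
  to_completion to_completion_is_zmod_morphism.
HB.instance Definition _ := GRing.isMonoidMorphism.Build R completion
  to_completion to_completion_is_monoid_morphism.

(* These sets are the neighbourhood base of 0 of the completion topology;
   completed i is the closure of the image of B i (closure_to_completion). *)
Definition completed (i : I) : set (completion) :=
  [set class_of a | a in [set a : cauchy_seq | eventually_in a (B i)]].

Lemma completed_class_of i a :
  completed i (class_of a) <-> eventually_in a (B i).
Proof.
split; last by exists a.
case=> b bi /class_of_eq/(_ i) bai; have [N NP] := eventually_inI bi bai.
exists N => n /NP [bn]; rewrite cauchy_seqBE => ban.
by rewrite -(subKr (b n) (a n)); exact: rbB.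
Qed.

Lemma completed_to_completion i q : completed i (to_completion q) <-> B i q.
Proof.
rewrite completed_class_of; split; first by case=> N /(_ N); exact.
by exists 0%N.
Qed.

Fact completed0 i : completed i 0.
Proof. by rewrite -(rmorph0 to_completion) completed_to_completion; exact: rb0. Qed.

Fact completedB i x y : completed i x -> completed i y -> completed i (x - y).
Proof.
move=> [a ai <-] [b bi <-]; rewrite -class_ofB completed_class_of.
have [N NP] := eventually_inI ai bi; exists N => n /NP[? ?].
by rewrite cauchy_seqBE; exact: rbB.
Qed.

Fact completedI i j : exists k, completed k `<=` completed i `&` completed j.
Proof.
have [k kP] := rbI B i j; exists k => _ [a [N NP] <-].
by split; apply/completed_class_of; exists N => n /NP/kP[].
Qed.

Fact completedZ x i : exists j, forall y, completed j y -> completed i (x * y).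
Proof.
have [c <-] := class_of_surj x; have [k kP] := rbM B i.
have [u uP] := cauchy_bound k (cauchy_seq_cauchy c).
have [i1 i1P] := rbZ B u i; have [j jP] := rbI B i1 k.
exists j => _ [a ai <-]; rewrite -class_ofM completed_class_of.
have [N NP] := eventually_inI uP ai; exists N => n /NP[cn /jP[an1 ank]].
rewrite cauchy_seqME -(subrK u (c n)) mulrDl; apply: rbD; last exact: i1P.
exact: kP.
Qed.

Fact completedM i : exists j, forall x y,
  completed j x -> completed j y -> completed i (x * y).
Proof.
have [j jP] := rbM B i; exists j => _ _ [a ai <-] [b bi <-].
rewrite -class_ofM completed_class_of; have [N NP] := eventually_inI ai bi.
by exists N => n /NP[? ?]; rewrite cauchy_seqME; exact: jP.
Qed.

Fact completed_sep x : (forall i, completed i x) -> x = 0.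
Proof.
have [a <-] := class_of_surj x => h.
rewrite -(rmorph0 to_completion); apply/class_of_eq => i.
have [N NP] := (completed_class_of i a).1 (h i); exists N => n /NP.
by rewrite cauchy_seqBE /= subr0.
Qed.

Definition completion_base : ringBase I completion :=
  RingBase (rb_inh B) completed0 completedB completedI completedZ completedM
    completed_sep.

HB.instance Definition _ := hasNbhs.Build completion (rb_nbhs completion_base).
HB.instance Definition _ := Nbhs_isNbhsTopological.Build completion
  (rb_nbhs_filter completion_base) (@rb_nbhs_singleton _ _ completion_base)
  (@rb_nbhs_nbhs _ _ completion_base).

Lemma completion_nbhsE (x : completion) (A : set completion) : nbhs x A <->
  exists i, [set y | completed i (y - x)] `<=` A.
Proof. by split=> [[i _ iA]|[i iA]]; exists i. Qed.

Lemma completion_sub_continuous :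
  continuous (fun x : completion * completion => x.1 - x.2).
Proof.
move=> [x y] A /(rb_nbhs_sub (B := completion_base)) [i _ iA].
exists ([set u | completed i (u - x)], [set v | completed i (v - y)]).
  by split; apply/completion_nbhsE; exists i.
by move=> [u v] [/= ? ?]; exact: iA.
Qed.

HB.instance Definition _ :=
  PreTopologicalNmodule_isTopologicalZmodule.Build completion
    completion_sub_continuous.

Lemma completion_mul_continuous :
  continuous (fun x : completion * completion => x.1 * x.2).
Proof.
move=> [x y] A /(rb_nbhs_mul (B := completion_base)) [i _ iA].
exists ([set u | completed i (u - x)], [set v | completed i (v - y)]).
  by split; apply/completion_nbhsE; exists i.
by move=> [u v] [/= ? ?]; exact: iA.
Qed.

Lemma to_completion_dense (x : completion) i :
  exists q, completed i (to_completion q - x).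
Proof.
have [a <-] := class_of_surj x.
have [q [N NP]] := cauchy_bound i (cauchy_seq_cauchy a); exists q.
rewrite -class_ofB completed_class_of; exists N => n /NP an.
by rewrite cauchy_seqBE /= -opprB; exact: rbN.
Qed.

Lemma closure_to_completion i : closure (to_completion @` B i) = completed i.
Proof.
apply/seteqP; split=> x.
- move=> /(_ [set y | completed i (y - x)]) [].
    by apply/completion_nbhsE; exists i.
  move=> _ [[q Bq <-] /= qx]; rewrite -(subKr (to_completion q) x).
  by apply: completedB => //; apply/completed_to_completion.
- move=> xi A /completion_nbhsE[j jA]; have [k kP] := completedI i j.
  have [q /kP[qi qj]] := to_completion_dense x k.
  exists (to_completion q); split; last exact: jA.
  exists q => //; apply/completed_to_completion.
  rewrite -(subrK x (to_completion q)).
  exact: (rbD (B := completion_base)).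
Qed.

End Completion.

Definition lcm_upto (N : nat) : nat := \big[lcmn/1%N]_(1 <= i < N.+1) i.

Definition is_lcm_value (v : nat) : Prop :=
  exists2 N, (0 < N)%N & v = lcm_upto N.

Lemma lcm_upto_gt0 N : (0 < lcm_upto N)%N.
Proof.
rewrite /lcm_upto; elim: N => [|N IH]; first by rewrite big_geq.
by rewrite big_nat_recr //= lcmn_gt0 IH.
Qed.

Lemma dvdn_lcm_upto d N : (0 < d <= N)%N -> (d %| lcm_upto N)%N.
Proof.
rewrite /lcm_upto; elim: N => [|N IH]; first by case: d.
case/andP=> d0; rewrite big_nat_recr //= leq_eqVlt => /predU1P[->|dN].
  exact: dvdn_lcmr.
by apply: dvdn_trans (dvdn_lcml _ _); apply: IH; rewrite d0.
Qed.

Lemma lcm_upto_homo : {homo lcm_upto : M N / (M <= N)%N >-> (M %| N)%N}.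
Proof.
apply: homo_leq => [n|m n p|N]; [exact: dvdnn|exact: dvdn_trans|].
by rewrite /lcm_upto [X in (_ %| X)%N]big_nat_recr //= dvdn_lcml.
Qed.

Lemma leq_lcm_upto N : (N <= lcm_upto N)%N.
Proof.
case: N => // N; apply: dvdn_leq; first exact: lcm_upto_gt0.
by apply: dvdn_lcm_upto; rewrite leqnn.
Qed.

Fact lcm_value_unbounded m : exists v, (m < v)%N && `[< is_lcm_value v >].
Proof.
exists (lcm_upto m.+1); rewrite leq_lcm_upto; apply/asboolP.
by exists m.+1.
Qed.

(* lcm_value n is m_n; that this is the increasing enumeration of the values
   of lcm(1,..,N), N >= 1, is lcm_value_incr, lcm_value_is, lcm_value_surj. *)
Fixpoint lcm_value (n : nat) : nat :=
  if n is n'.+1 then ex_minn (lcm_value_unbounded (lcm_value n')) else 1%N.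

Arguments lcm_value : simpl never.

Lemma lcm_value_spec n : [/\ (lcm_value n < lcm_value n.+1)%N,
  is_lcm_value (lcm_value n.+1) &
  forall v, is_lcm_value v -> (lcm_value n < v)%N ->
    (lcm_value n.+1 <= v)%N].
Proof.
rewrite /lcm_value -/lcm_value; case: ex_minnP => m /andP[lt_m /asboolP vm] mP; split=> // v vv lt_v.
by apply: mP; rewrite lt_v; apply/asboolP.
Qed.

Lemma lcm_value_incr : {homo lcm_value : m n / (m < n)%N}.
Proof.
apply: homo_ltn => [m n p|n]; first exact: ltn_trans.
by have [] := lcm_value_spec n.
Qed.

Lemma lcm_value_is n : is_lcm_value (lcm_value n).
Proof.
case: n => [|n]; last by have [] := lcm_value_spec n.
by exists 1%N => //; rewrite /lcm_upto big_nat1.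
Qed.

Lemma ltn_lcm_value n : (n < lcm_value n)%N.
Proof.
elim: n => // n IH; apply: leq_ltn_trans IH _.
by have [] := lcm_value_spec n.
Qed.

Lemma lcm_value_gt0 n : (0 < lcm_value n)%N.
Proof. exact: leq_ltn_trans (ltn_lcm_value n). Qed.

Lemma lcm_value_surj v : is_lcm_value v -> exists n, lcm_value n = v.
Proof.
move=> vv; have ex : exists n, (v <= lcm_value n)%N.
  by exists v; exact/ltnW/ltn_lcm_value.
case: (ex_minnP ex) => -[|n] vn nP.
  exists 0%N; apply/eqP; rewrite eqn_leq vn andbT.
  by have [N _ ->] := vv; exact: lcm_upto_gt0.
exists n.+1; apply/eqP; rewrite eqn_leq vn andbT.
have [_ _] := lcm_value_spec n; apply => //.
by rewrite ltnNge; apply/negP => /nP; rewrite ltnn.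
Qed.

Lemma lcm_value_dvd m n : (m <= n)%N -> (lcm_value m %| lcm_value n)%N.
Proof.
move=> mn; have [M _ eM] := lcm_value_is m; have [N _ eN] := lcm_value_is n.
have [MN|/ltnW/lcm_upto_homo] := leqP M N.
  by rewrite eM eN; exact: lcm_upto_homo.
rewrite -eM -eN => nm; suff -> : lcm_value m = lcm_value n by exact: dvdnn.
apply/eqP; rewrite eqn_leq (dvdn_leq (lcm_value_gt0 _) nm) andbT.
by move: mn; rewrite leq_eqVlt => /predU1P[->//|/lcm_value_incr/ltnW].
Qed.

Lemma dvdn_lcm_value d : (0 < d)%N -> exists n, (d %| lcm_value n)%N.
Proof.
move=> d0; have [n nd] : exists n, lcm_value n = lcm_upto d.
  by apply: lcm_value_surj; exists d.
by exists n; rewrite nd; apply: dvdn_lcm_upto; rewrite d0 leqnn.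
Qed.

(* e_psi k is e^{psi(k)}: m_k for k >= 0 and 1/m_{-k} for k < 0
   (Negz n denotes -(n+1)). *)
Definition e_psi (k : int) : rat :=
  match k with
  | Posz n => (lcm_value n)%:R
  | Negz n => (lcm_value n.+1)%:R^-1
  end.

Definition finite_adelic_set (k : int) : set rat :=
  [set e_psi k * z%:~R | z in [set: int]].

Lemma e_psi_dvd (i k : int) : (i <= k)%R -> exists z : int, e_psi k = e_psi i * z%:~R.
Proof.
have nz n : (lcm_value n)%:R != 0 :> rat by rewrite pnatr_eq0 -lt0n lcm_value_gt0.
case: i k => [i|i] [k|k] //= ik.
- have /dvdnP[c ->] := lcm_value_dvd ik.
  by exists c; rewrite natrM mulrC.
- by exists (lcm_value i.+1 * lcm_value k)%N; rewrite -pmulrn natrM mulKf ?nz.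
- have /dvdnP[c cE] : (lcm_value k.+1 %| lcm_value i.+1)%N.
    by apply: lcm_value_dvd; move: ik; rewrite !NegzE lerN2.
  exists c; rewrite -[X in X * _]mul1r.
  have c0 : (c%:R : rat) != 0.
    by apply: contraNneq (nz i.+1) => c0; rewrite cE natrM c0 mul0r.
  by rewrite cE natrM invfM mul1r mulrC mulrA -pmulrn mulfV // mul1r.
Qed.

Lemma finite_adelic_set_le (i k : int) : (i <= k)%R ->
  finite_adelic_set k `<=` finite_adelic_set i.
Proof.
move=> /e_psi_dvd[c ckE] _ [z _ <-]; exists (c * z)%R => //.
by rewrite ckE intrM mulrA.
Qed.

Lemma finite_adelic_set_abs (i : int) :
  finite_adelic_set `|i|%N `<=` finite_adelic_set i.
Proof. by apply: finite_adelic_set_le; rewrite abszE ler_norm. Qed.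

Fact finite_adelic_set0 i : finite_adelic_set i 0.
Proof. by exists 0 => //; rewrite mulr0. Qed.

Fact finite_adelic_setB i x y : finite_adelic_set i x ->
  finite_adelic_set i y -> finite_adelic_set i (x - y).
Proof. by move=> [a _ <-] [b _ <-]; exists (a - b) => //; rewrite intrB mulrBr. Qed.

Fact finite_adelic_setI i j : exists k,
  finite_adelic_set k `<=` finite_adelic_set i `&` finite_adelic_set j.
Proof.
exists (Order.max i j) => x xm; split; apply: finite_adelic_set_le xm.
  by rewrite le_max lexx.
by rewrite le_max lexx orbT.
Qed.

Fact finite_adelic_setZ x i : exists j, forall y,
  finite_adelic_set j y -> finite_adelic_set i (x * y).
Proof.
have [|n] := @dvdn_lcm_value (`|denq x| * lcm_value `|i|)%N.
  by rewrite muln_gt0 absz_gt0 denq_neq0 lcm_value_gt0.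
move=> /dvdnP[c cE]; exists (Posz n) => _ [z _ <-]; apply: finite_adelic_set_abs.
exists (numq x * c%:Z * z) => //=; rewrite cE !natrM.
have dE : (`|denq x|%:R : rat) = (denq x)%:~R.
  by rewrite pmulrn absz_denq.
rewrite dE !intrM -[X in _ = X * _]divq_num_den.
have : ((denq x)%:~R : rat) != 0 by rewrite intr_eq0 denq_neq0.
by move=> ?; rewrite -pmulrn; field.
Qed.

Fact finite_adelic_setM i : exists j, forall x y,
  finite_adelic_set j x -> finite_adelic_set j y -> finite_adelic_set i (x * y).
Proof.
exists `|i|%N => _ _ [a _ <-] [b _ <-]; apply: finite_adelic_set_abs.
exists ((lcm_value `|i|)%:Z * a * b) => //=.
by rewrite !intrM -pmulrn; ring.
Qed.

Fact finite_adelic_set_sep x : (forall i, finite_adelic_set i x) -> x = 0.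
Proof.
move=> h; have [z _ /= zx] := h 0; rewrite mul1r in zx.
have [y _ /= yx] := h `|z|%N; apply/eqP; rewrite -zx intr_eq0.
move: yx; rewrite -zx pmulrn -intrM => /intr_inj /(congr1 absz).
rewrite abszM absz_nat -absz_eq0; have [->|y0] := posnP `|y|%N.
  by rewrite muln0 => <-.
move=> yz; have := leq_pmulr (lcm_value `|z|) y0.
by rewrite yz leqNgt ltn_lcm_value.
Qed.

Definition finite_adelic_base : ringBase int rat :=
  RingBase (inhabits 0) finite_adelic_set0 finite_adelic_setB
    finite_adelic_setI finite_adelic_setZ finite_adelic_setM
    finite_adelic_set_sep.

Notation Qbar := (completion finite_adelic_base).

Definition prime_number := {p : nat | prime p}.

(* Z_(p) = {y in Q : |y|_p <= 1}; denq y is the reduced denominator. *)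
Definition local_int (p : prime_number) : set rat :=
  [set y | ~~ (val p %| `|denq y|)%N].

(* p^k Z_(p) = {x in Q : |x|_p <= p^(-k)} *)
Definition padic_set (p : prime_number) (k : int) : set rat :=
  [set (val p)%:R ^ k * y | y in local_int p].

Section Padic.
Variable p : prime_number.
Let p_pr : prime (val p) := valP p.

Let p_neq0 : (val p)%:R != 0 :> rat.
Proof. by rewrite pnatr_eq0 -lt0n prime_gt0. Qed.

Lemma local_intP (y : rat) : local_int p y <->
  exists a b : int, ~~ (val p %| `|b|)%N /\ y = a%:~R / b%:~R.
Proof.
split=> [py|[a [b [pb eqy]]]].
  by exists (numq y), (denq y); rewrite divq_num_den.
apply: contraNN pb => pd.
have [->|b0] := eqVneq b 0; first by rewrite dvdn0.
have : b * numq y = a * denq y.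
  apply: (@intr_inj rat); rewrite !intrM.
  by rewrite numqE {1}eqy mulrA [b%:~R * _]mulrC divfK // intr_eq0.
move=> /(congr1 absz); rewrite !abszM => e.
have : (val p %| `|b| * `|numq y|)%N by rewrite e dvdn_mull.
rewrite Euclid_dvdM // => /orP[//|pn].
have := coprime_num_den y; rewrite /coprime => /eqP g1.
have : (val p %| gcdn `|numq y| `|denq y|)%N by rewrite dvdn_gcd pn pd.
by rewrite g1 dvdn1 => /eqP p1; move: p_pr; rewrite p1.
Qed.

Lemma local_int_int (z : int) : local_int p z%:~R.
Proof.
apply/local_intP; exists z, 1; split; last by rewrite divr1.
by rewrite dvdn1 neq_ltn prime_gt1 ?orbT.
Qed.

Lemma local_intB x y : local_int p x -> local_int p y -> local_int p (x - y).
Proof.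
move=> /local_intP[a [b [pb ->]]] /local_intP[c [d [pd ->]]]; apply/local_intP.
exists (a * d - c * b), (b * d); rewrite abszM Euclid_dvdM // negb_or pb pd.
split=> //; have nz (e : int) : ~~ (val p %| `|e|)%N -> e%:~R != 0 :> rat.
  by rewrite intr_eq0; apply: contraNneq => ->; rewrite dvdn0.
have := nz _ pb; have := nz _ pd; rewrite intrB !intrM => ? ?.
by field; apply/andP; split.
Qed.

Lemma local_intM x y : local_int p x -> local_int p y -> local_int p (x * y).
Proof.
move=> /local_intP[a [b [pb ->]]] /local_intP[c [d [pd ->]]]; apply/local_intP.
exists (a * c), (b * d); rewrite abszM Euclid_dvdM // negb_or pb pd.
by split=> //; rewrite !intrM invfM mulrACA.
Qed.

Lemma padic_set_le (i k : int) : i <= k -> padic_set p k `<=` padic_set p i.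
Proof.
move=> ik _ [y yp <-]; exists ((val p)%:R ^ (k - i) * y).
  apply: local_intM => //; have : 0 <= k - i by rewrite subr_ge0.
  case: (k - i) => // n _.
  rewrite [_ ^ _](_ : _ = ((val p ^ n)%N%:Z)%:~R); first exact: local_int_int.
  by rewrite -pmulrn natrX.
by rewrite mulrA -expfzDr // addrC subrK.
Qed.

Lemma padic_set_unbounded x : exists k, padic_set p k x.
Proof.
set d := `|denq x|%N; have d0 : (0 < d)%N by rewrite absz_gt0 denq_neq0.
exists (- (logn (val p) d)%:Z).
have [m pm dE] := pfactor_coprime p_pr d0.
exists ((numq x)%:~R / m%:R).
  apply/local_intP; exists (numq x), m; split=> //.
  by rewrite absz_nat -prime_coprime.
rewrite -[in RHS](divq_num_den x).
have -> : (denq x)%:~R = d%:R :> rat by rewrite pmulrn absz_denq.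
rewrite {2}dE natrM natrX invfM mulrCA; congr (_ * _).
by rewrite mulrC exprnN.
Qed.

Fact padic_set0 i : padic_set p i 0.
Proof. by exists 0; [exact: (local_int_int 0)|rewrite mulr0]. Qed.

Fact padic_setB i x y :
  padic_set p i x -> padic_set p i y -> padic_set p i (x - y).
Proof.
move=> [a pa <-] [b pb <-]; exists (a - b); last by rewrite mulrBr.
exact: local_intB.
Qed.

Fact padic_setI i j :
  exists k, padic_set p k `<=` padic_set p i `&` padic_set p j.
Proof.
exists (Order.max i j) => x xm; split; apply: padic_set_le xm.
  by rewrite le_max lexx.
by rewrite le_max lexx orbT.
Qed.

Lemma padic_setMD i j x y :
  padic_set p i x -> padic_set p j y -> padic_set p (i + j) (x * y).
Proof.
move=> [a pa <-] [b pb <-]; exists (a * b); first exact: local_intM.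
by rewrite expfzDr // mulrACA.
Qed.

Fact padic_setZ x i :
  exists j, forall y, padic_set p j y -> padic_set p i (x * y).
Proof.
have [k kx] := padic_set_unbounded x; exists (i - k) => y jy.
by rewrite -(subrK k i) addrC; exact: padic_setMD.
Qed.

Fact padic_setM i : exists j, forall x y,
  padic_set p j x -> padic_set p j y -> padic_set p i (x * y).
Proof.
exists `|i| => x y ix iy; apply: padic_set_le (padic_setMD ix iy).
by apply: le_trans (ler_norm i) _; rewrite lerDl.
Qed.

Fact padic_set_sep x : (forall i, padic_set p i x) -> x = 0.
Proof.
move=> h; set n := `|numq x|%N; have [y py yx] := h n.
apply/eqP; rewrite -numq_eq0 -absz_eq0 -/n; apply/negPn/negP => n0.
have : numq x * denq y = (val p ^ n)%N%:Z * (numq y * denq x).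
  apply: (@intr_inj rat); rewrite !intrM -pmulrn natrX.
  by rewrite !numqE -{1}yx -!mulrA; congr (_ * (_ * _)); rewrite mulrC.
move=> /(congr1 absz); rewrite !abszM absz_nat -/n => e.
have : (val p ^ n %| n * `|denq y|)%N by rewrite e dvdn_mulr.
rewrite Gauss_dvdl; last by rewrite coprimeXl // prime_coprime.
move=> /(dvdn_leq _); rewrite lt0n n0 => /(_ isT).
by rewrite leqNgt ltn_expl // prime_gt1.
Qed.

Definition padic_base : ringBase int rat :=
  RingBase (inhabits 0) padic_set0 padic_setB padic_setI padic_setZ padic_setM
    padic_set_sep.

End Padic.

Notation Qp p := (completion (padic_base p)).

(* The p-adic integers: classes of sequences eventually in Z_(p), i.e. the
   closure of Z_(p) = p^0 Z_(p) in Q_p. *)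
Definition Zp (p : prime_number) : set (Qp p) := completed (B := padic_base p) 0.

Section PadicIntegers.
Variable p : prime_number.

Lemma padic_set_int (z : int) : padic_set p 0 z%:~R.
Proof. by exists z%:~R; [exact: local_int_int|rewrite expr0z mul1r]. Qed.

Lemma Zp_int (z : int) : Zp (to_completion (padic_base p) z%:~R).
Proof. by apply/completed_to_completion; exact: padic_set_int. Qed.

Lemma completed_padicMD (i j : int) (x y : Qp p) :
  completed i x -> completed j y -> completed (i + j) (x * y).
Proof.
move=> [a ai <-] [b bi <-]; rewrite -class_ofM completed_class_of.
have [N NP] := eventually_inI ai bi; exists N => n /NP[? ?].
by rewrite cauchy_seqME; exact: padic_setMD.
Qed.

Lemma ZpM (x y : Qp p) : Zp x -> Zp y -> Zp (x * y).
Proof. exact: (@completed_padicMD 0 0). Qed.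

Lemma Zp_clear (x : Qp p) :
  exists2 n : nat, n != 0%N & Zp (to_completion _ n%:R * x).
Proof.
have [a <-] := class_of_surj x.
have [q qP] := cauchy_bound (B := padic_base p) 0 (cauchy_seq_cauchy a).
have [k kq] := padic_set_unbounded p q.
have [m mk] : exists m : nat, forall y, padic_set p 0 y \/ padic_set p k y ->
    padic_set p (- m%:Z) y.
  exists `|k|%N => y [|]; apply: padic_set_le; first by rewrite oppr_le0.
  by rewrite abszE lerNl -normrN ler_norm.
exists (val p ^ m)%N; first by rewrite -lt0n expn_gt0 prime_gt0 ?(valP p).
rewrite -class_ofM; apply/completed_class_of; have [N NP] := qP.
exists N => n /NP an; rewrite cauchy_seqME /=.
rewrite -(subrr m%:Z).
apply: padic_setMD.
  by exists 1; [exact: (local_int_int p 1)|rewrite mulr1 natrX].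
rewrite -(subrK q (a n)).
by apply: (rbD (B := padic_base p)); apply: mk; [left|right].
Qed.

End PadicIntegers.

Definition prod_Qp := forall p : prime_number, Qp p.

HB.instance Definition _ := Choice.on prod_Qp.

Section ProdQp.

Let zero : prod_Qp := fun p => 0.
Let one : prod_Qp := fun p => 1.
Let add (x y : prod_Qp) : prod_Qp := fun p => x p + y p.
Let opp (x : prod_Qp) : prod_Qp := fun p => - x p.
Let mul (x y : prod_Qp) : prod_Qp := fun p => x p * y p.

Let addA : associative add.
Proof. by move=> x y z; apply: functional_extensionality_dep => p; exact: addrA. Qed.
Let addC : commutative add.
Proof. by move=> x y; apply: functional_extensionality_dep => p; exact: addrC. Qed.
Let add0 : left_id zero add.
Proof. by move=> x; apply: functional_extensionality_dep => p; exact: add0r. Qed.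
Let addN : left_inverse zero opp add.
Proof. by move=> x; apply: functional_extensionality_dep => p; exact: addNr. Qed.

HB.instance Definition _ := GRing.isZmodule.Build prod_Qp addA addC add0 addN.

Let mulA : associative mul.
Proof. by move=> x y z; apply: functional_extensionality_dep => p; exact: mulrA. Qed.
Let mulC : commutative mul.
Proof. by move=> x y; apply: functional_extensionality_dep => p; exact: mulrC. Qed.
Let mul1 : left_id one mul.
Proof. by move=> x; apply: functional_extensionality_dep => p; exact: mul1r. Qed.
Let mulD : left_distributive mul +%R.
Proof. by move=> x y z; apply: functional_extensionality_dep => p; exact: mulrDl. Qed.
Let one_neq0 : one != 0.
Proof.
apply/eqP => /(congr1 (fun f : prod_Qp => f (exist _ 2%N isT))).
by move/eqP; rewrite oner_eq0.
Qed.

HB.instance Definition _ :=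
  GRing.Zmodule_isComNzRing.Build prod_Qp mulA mulC mul1 mulD one_neq0.

End ProdQp.

Definition almost_integral : {pred prod_Qp} :=
  fun x => `[< finite_set [set p | ~ Zp (x p)] >].

Lemma almost_integralP x :
  reflect (finite_set [set p | ~ Zp (x p)]) (x \in almost_integral).
Proof. exact: asboolP. Qed.

Lemma almost_integral_subring : subring_closed almost_integral.
Proof.
split.
- apply/almost_integralP; rewrite (_ : mkset _ = set0); first exact: finite_set0.
  rewrite -subset0 => p /=; apply.
  by have := Zp_int p 1; rewrite rmorph1.
- move=> x y /almost_integralP hx /almost_integralP hy; apply/almost_integralP.
  have hxy : finite_set ([set p | ~ Zp (x p)] `|` [set p | ~ Zp (y p)]).
    by rewrite finite_setU.
  apply: sub_finite_set hxy => p /=.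
  move=> xyp; apply: contrapT => /not_orP[/contrapT xp /contrapT yp]; apply: xyp.
  exact: completedB.
- move=> x y /almost_integralP hx /almost_integralP hy; apply/almost_integralP.
  have hxy : finite_set ([set p | ~ Zp (x p)] `|` [set p | ~ Zp (y p)]).
    by rewrite finite_setU.
  apply: sub_finite_set hxy => p /=.
  move=> xyp; apply: contrapT => /not_orP[/contrapT xp /contrapT yp]; apply: xyp.
  exact: ZpM.
Qed.

HB.instance Definition _ :=
  GRing.isSubringClosed.Build prod_Qp almost_integral almost_integral_subring.

Record finite_adele := FiniteAdele {
  adele_fun : prod_Qp; _ : adele_fun \in almost_integral }.

HB.instance Definition _ := [isSub for adele_fun].
HB.instance Definition _ := [Choice of finite_adele by <:].
HB.instance Definition _ := [SubChoice_isSubComNzRing of finite_adele by <:].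

Definition component (x : finite_adele) (p : prime_number) : Qp p :=
  adele_fun x p.

Coercion component : finite_adele >-> Funclass.

Lemma finite_adeleBE (x y : finite_adele) p : (x - y) p = x p - y p.
Proof. by []. Qed.

Lemma finite_adeleME (x y : finite_adele) p : (x * y) p = x p * y p.
Proof. by []. Qed.

Lemma finite_adeleP (x y : finite_adele) : (forall p, x p = y p) -> x = y.
Proof. by move=> xy; apply: val_inj; apply: functional_extensionality_dep. Qed.

Lemma diag_almost_integral (q : rat) :
  (fun p => to_completion (padic_base p) q : Qp p) \in almost_integral.
Proof.
apply/almost_integralP.
pose D := [set` primes `|denq q|%N].
have fD : finite_set D by exact: finite_seq.
have : finite_set (val @^-1` D : set prime_number).
  by apply: finite_preimage fD => p p' _ _; exact: val_inj.
apply: sub_finite_set => p /= pq; rewrite /D /= mem_primes (valP p) /=.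
rewrite absz_gt0 denq_neq0 /=; apply: contrapT => /negP pd; apply: pq.
by apply/completed_to_completion; exists q; rewrite // expr0z mul1r.
Qed.

Definition diag (q : rat) : finite_adele := FiniteAdele (diag_almost_integral q).

Lemma diagE q p : diag q p = to_completion (padic_base p) q.
Proof. by []. Qed.

Lemma diag_is_zmod_morphism : zmod_morphism diag.
Proof. by move=> x y; apply: finite_adeleP => p; rewrite /= rmorphB. Qed.

Lemma diag_is_monoid_morphism : monoid_morphism diag.
Proof.
split; first by apply: finite_adeleP => p; rewrite /= rmorph1.
by move=> x y; apply: finite_adeleP => p; rewrite /= rmorphM.
Qed.

HB.instance Definition _ :=
  GRing.isZmodMorphism.Build rat finite_adele diag diag_is_zmod_morphism.
HB.instance Definition _ :=
  GRing.isMonoidMorphism.Build rat finite_adele diag diag_is_monoid_morphism.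

Definition integral_adele : set finite_adele := [set x | forall p, Zp (x p)].

(* q * prod_p Z_p; these sets are the base at 0 of the restricted product
   topology. *)
Definition adele_set (q : {q : rat | q != 0}) : set finite_adele :=
  [set diag (val q) * x | x in integral_adele].

Lemma integral_adele_int (z : int) : integral_adele (diag z%:~R).
Proof. by move=> p; exact: Zp_int. Qed.

Lemma integral_adeleM x y :
  integral_adele x -> integral_adele y -> integral_adele (x * y).
Proof. by move=> hx hy p; rewrite finite_adeleME; exact: ZpM. Qed.

Lemma adele_set_int (q : {q : rat | q != 0}) (z : int) x :
  integral_adele x -> adele_set q (diag (val q * z%:~R) * x).
Proof.
move=> hx; exists (diag z%:~R * x); last by rewrite mulrA rmorphM.
by apply: integral_adeleM => //; exact: integral_adele_int.
Qed.

Lemma clear_denominators (x : finite_adele) :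
  exists2 n : nat, n != 0%N & integral_adele (diag n%:R * x).
Proof.
case: x => x hx; have /almost_integralP/finite_seqP[s sE] := hx.
have {sE} : forall p, p \notin s -> Zp (x p).
  move=> p ps; apply: contrapT => np; move/negP: ps; apply.
  by have : [set` s] p by rewrite -sE.
elim: s x hx => [|p s IH] x hx xs.
  by exists 1%N => // q; rewrite rmorph1 mul1r; exact: xs.
have [m m0 mx] := Zp_clear (x p).
pose y := diag m%:R * FiniteAdele hx.
have [q qs|n n0 ny] := IH (val y) (valP y).
  have [->//|qp] := eqVneq q p.
  apply: ZpM; first exact: (Zp_int q m).
  by apply: xs; rewrite inE negb_or qp.
exists (n * m)%N; first by rewrite muln_eq0 negb_or n0.
rewrite natrM rmorphM -mulrA (_ : diag m%:R * _ = FiniteAdele (valP y)) //.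
exact: val_inj.
Qed.

Fact adele_set0 q : adele_set q 0.
Proof.
exists 0; last by rewrite mulr0.
by rewrite -(rmorph0 diag); exact: (integral_adele_int 0).
Qed.

Fact adele_setB q x y : adele_set q x -> adele_set q y -> adele_set q (x - y).
Proof.
move=> [a ai <-] [b bi <-]; exists (a - b); last by rewrite mulrBr.
by move=> p; rewrite finite_adeleBE; exact: completedB (ai p) (bi p).
Qed.

Fact adele_setI q r : exists s, adele_set s `<=` adele_set q `&` adele_set r.
Proof.
have s0 : (numq (val q) * numq (val r))%:~R != 0 :> rat.
  by rewrite intr_eq0 mulf_neq0 // numq_eq0 (valP q, valP r).
exists (exist (fun q : rat => q != 0) _ s0) => _ [x xi <-]; split; rewrite [val _]/=.
  by rewrite intrM numqE -mulrA -intrM; exact: adele_set_int.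
rewrite intrM (numqE (val r)) mulrCA -intrM; exact: adele_set_int.
Qed.

Fact adele_setZ x q : exists r, forall y, adele_set r y -> adele_set q (x * y).
Proof.
have [n n0 nx] := clear_denominators x.
have r0 : val q * n%:R != 0 by rewrite mulf_neq0 ?(valP q) // pnatr_eq0.
exists (exist (fun q : rat => q != 0) _ r0) => _ [y yi <-]; exists (diag n%:R * x * y).
  exact: integral_adeleM.
by rewrite [val _]/= rmorphM; ring.
Qed.

Fact adele_setM q : exists r, forall x y,
  adele_set r x -> adele_set r y -> adele_set q (x * y).
Proof.
have r0 : (numq (val q))%:~R != 0 :> rat by rewrite intr_eq0 numq_eq0 (valP q).
exists (exist (fun q : rat => q != 0) _ r0) => _ _ [x xi <-] [y yi <-]; rewrite [val _]/=.
have -> : diag (numq (val q))%:~R * x * (diag (numq (val q))%:~R * y) =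
  diag (val q * (denq (val q) * numq (val q))%:~R) * (x * y).
  by rewrite intrM [val q * _]mulrA -numqE rmorphM mulrACA.
by apply: adele_set_int; exact: integral_adeleM.
Qed.

Fact adele_set_sep x : (forall q, adele_set q x) -> x = 0.
Proof.
move=> h; apply: finite_adeleP => p; apply: (completed_sep (B := padic_base p)) => k.
have q0 : (val p)%:R ^ k != 0 :> rat.
  by rewrite expfz_neq0 // pnatr_eq0 -lt0n prime_gt0 // (valP p).
have [y yi <-] := h (exist (fun q : rat => q != 0) _ q0); rewrite finite_adeleME.
have kp : completed (B := padic_base p) k (diag ((val p)%:R ^ k) p).
  apply/completed_to_completion; exists 1; last by rewrite mulr1.
  exact: (local_int_int p 1).
by have := completed_padicMD kp (yi p); rewrite addr0.
Qed.

Fact adele_inh : inhabited {q : rat | q != 0}.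
Proof. by constructor; exists 1; exact: oner_neq0. Qed.

Definition adele_base : ringBase {q : rat | q != 0} finite_adele :=
  RingBase adele_inh adele_set0 adele_setB adele_setI adele_setZ adele_setM
    adele_set_sep.

HB.instance Definition _ := hasNbhs.Build finite_adele (rb_nbhs adele_base).
HB.instance Definition _ := Nbhs_isNbhsTopological.Build finite_adele
  (rb_nbhs_filter adele_base) (@rb_nbhs_singleton _ _ adele_base)
  (@rb_nbhs_nbhs _ _ adele_base).

Lemma adele_nbhsE (x : finite_adele) (A : set finite_adele) : nbhs x A <->
  exists q, [set y | adele_set q (y - x)] `<=` A.
Proof. by split=> [[q _ qA]|[q qA]]; exists q. Qed.

Lemma adele_sub_continuous :
  continuous (fun x : finite_adele * finite_adele => x.1 - x.2).
Proof.
move=> [x y] A /(rb_nbhs_sub (B := adele_base)) [i _ iA].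
exists ([set u | adele_set i (u - x)], [set v | adele_set i (v - y)]).
  by split; apply/adele_nbhsE; exists i.
by move=> [u v] [/= ? ?]; exact: iA.
Qed.

HB.instance Definition _ :=
  PreTopologicalNmodule_isTopologicalZmodule.Build finite_adele
    adele_sub_continuous.

Lemma adele_mul_continuous :
  continuous (fun x : finite_adele * finite_adele => x.1 * x.2).
Proof.
move=> [x y] A /(rb_nbhs_mul (B := adele_base)) [i _ iA].
exists ([set u | adele_set i (u - x)], [set v | adele_set i (v - y)]).
  by split; apply/adele_nbhsE; exists i.
by move=> [u v] [/= ? ?]; exact: iA.
Qed.

(* Main.v *)
(* A sequence that is Cauchy for the finite adelic topology is p-adically
   Cauchy for every p, which gives a ring morphism Qbar -> A_f. A rational
   lies in e^{psi(k)} Z iff it lies in e^{psi(k)} Z_(p) for every p; as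
   differences of late terms of a Cauchy sequence lie in e^{psi(k)} Z, this
   local-global principle passes to the completion, so a class lies in the
   k-th basic neighbourhood of 0 iff its image lies in e^{psi(k)} prod_p Z_p.
   Hence the map is injective and a homeomorphism onto its image. It is
   surjective because Q is dense in A_f: if n x is integral, divide out the
   primes of n one at a time, an integral adele being congruent mod p to an
   integer. *)
Require Import Defs.
From HB Require Import structures.
From mathcomp Require Import all_boot all_order all_algebra ring.
From mathcomp Require Import all_classical topology tvs.

Set Implicit Arguments.
Unset Strict Implicit.
Unset Printing Implicit Defensive.

Import Order.TTheory GRing.Theory Num.Theory.

Local Open Scope classical_set_scope.
Local Open Scope ring_scope.

(** * Passage to the completion for a coarser ring topology *)

Section Coarsen.
Variables (I J : Type) (R : comNzRingType) (B : ringBase I R) (C : ringBase J R).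
Hypothesis BC : forall j, exists i, B i `<=` C j.

Lemma coarsen_cauchy (a : cauchy_seq B) : (a : nat -> R) \in Defs.cauchy C.
Proof.
apply/Defs.cauchyP => j; have [i iP] := BC j.
have [N NP] := Defs.cauchyP _ _ (cauchy_seq_cauchy a) i.
by exists N => n m Nn Nm; apply: iP; exact: NP.
Qed.

Definition coarsen_seq (a : cauchy_seq B) : cauchy_seq C :=
  CauchySeq (coarsen_cauchy a).

(** Evaluated on a chosen representative; [coarsen_class_of] shows that the choice is immaterial. *)
Definition coarsen (x : completion B) : completion C :=
  class_of (coarsen_seq (repr x)).

Lemma coarsen_class_of a : coarsen (class_of a) = class_of (coarsen_seq a).
Proof.
apply/class_of_eq => j; have [i iP] := BC j.
have /class_of_eq/(_ i)[N NP] : class_of (repr (class_of a)) = class_of a.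
  by rewrite /class_of reprK.
by exists N => n /NP/iP.
Qed.

Lemma coarsen_is_zmod_morphism : zmod_morphism coarsen.
Proof.
move=> x y; have [a <-] := class_of_surj x; have [b <-] := class_of_surj y.
rewrite -class_ofB !coarsen_class_of -class_ofB.
by congr class_of; apply: val_inj.
Qed.

Lemma coarsen_to_completion q :
  coarsen (to_completion B q) = to_completion C q.
Proof. by rewrite coarsen_class_of; congr class_of; apply: val_inj. Qed.

Lemma coarsen_is_monoid_morphism : monoid_morphism coarsen.
Proof.
split=> [|x y].
  by rewrite -(rmorph1 (to_completion B)) coarsen_to_completion rmorph1.
have [a <-] := class_of_surj x; have [b <-] := class_of_surj y.
rewrite -class_ofM !coarsen_class_of -class_ofM.
by congr class_of; apply: val_inj.
Qed.

HB.instance Definition _ := GRing.isZmodMorphism.Build (completion B)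
  (completion C) coarsen coarsen_is_zmod_morphism.
HB.instance Definition _ := GRing.isMonoidMorphism.Build (completion B)
  (completion C) coarsen coarsen_is_monoid_morphism.

Lemma completed_coarsen i j x : B i `<=` C j ->
  completed i x -> completed j (coarsen x).
Proof.
move=> ij [a [N NP] <-]; rewrite coarsen_class_of completed_class_of.
by exists N => n /NP/ij.
Qed.

End Coarsen.

(** * Local-global principle for rationals *)

Lemma padic_set0E p : padic_set p 0 = local_int p.
Proof.
apply/seteqP; split=> [_ [y py <-]|y py]; first by rewrite expr0z mul1r.
by exists y; rewrite // expr0z mul1r.
Qed.

(** A reduced denominator above 1 would have a prime factor, and [r] is not integral at that
    prime. *)
Lemma int_local (r : rat) :
  (forall p, local_int p r) -> exists z : int, r = z%:~R.
Proof.
move=> h; exists (numq r); apply/esym; rewrite -[RHS]divq_num_den.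
suff -> : denq r = 1 by rewrite divr1.
rewrite -absz_denq; case: (ltnP 1 `|denq r|) => [d1|].
  have := h (exist (fun p => prime p) _ (pdiv_prime d1)); rewrite /local_int /=.
  by rewrite pdiv_dvd.
by have := denq_neq0 r; rewrite -absz_gt0; case: `|denq r|%N => [|[]].
Qed.

Lemma e_psi_neq0 k : e_psi k != 0.
Proof.
have h n : (lcm_value n)%:R != 0 :> rat.
  by rewrite pnatr_eq0 -lt0n lcm_value_gt0.
by case: k => n /=; rewrite ?invr_eq0 h.
Qed.

Lemma finite_adelic_setE k r :
  finite_adelic_set k r <-> forall p, local_int p ((e_psi k)^-1 * r).
Proof.
split=> [[z _ <-] p|/int_local[z zr]].
  by rewrite mulKf ?e_psi_neq0 //; exact: local_int_int.
by exists z => //; rewrite -zr mulVKf ?e_psi_neq0.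
Qed.

(** Some [m_n] is divisible by [p ^ |i|]; the absolute value keeps the exponent natural when [i] is
    negative. *)
Lemma finite_adelic_padic p i :
  exists k, finite_adelic_base k `<=` padic_base p i.
Proof.
have p0 : (0 < val p ^ `|i|)%N by rewrite expn_gt0 prime_gt0 ?(valP p).
have [n /dvdnP[c cE]] := dvdn_lcm_value p0.
exists (Posz n) => _ [z _ <-]; apply: (@padic_set_le p _ `|i|%N%:Z).
  by rewrite abszE ler_norm.
exists (c%:Z * z)%:~R; first exact: local_int_int.
by rewrite /= cE natrM natrX intrM -pmulrn mulrCA mulrA.
Qed.

Lemma Zp_to_completion p q :
  Defs.Zp (to_completion (padic_base p) q) <-> local_int p q.
Proof. by rewrite /Defs.Zp completed_to_completion /= padic_set0E. Qed.

(** * The ring morphism from the completion to the finite adeles *)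

Lemma Zp_coarsen p x :
  completed 0 x -> Defs.Zp (coarsen (@finite_adelic_padic p) x).
Proof.
apply: completed_coarsen => r /finite_adelic_setE/(_ p).
by rewrite invr1 mul1r /= padic_set0E.
Qed.

(** Up to an element integral at every prime, [x] is a rational [q], so it can fail to be integral
    only at the primes where [q] does. *)
Lemma coarsen_almost_integral (x : Qbar) :
  (fun p => coarsen (@finite_adelic_padic p) x : Qp p) \in almost_integral.
Proof.
have [q qx] := to_completion_dense x 0.
apply/almost_integralP.
have /almost_integralP := diag_almost_integral q.
apply: sub_finite_set => p /= xp qp; apply: xp.
rewrite -(subKr (to_completion finite_adelic_base q) x) rmorphB /=.
rewrite coarsen_to_completion.
by apply: completedB => //; exact: Zp_coarsen.
Qed.

Definition adele_of (x : Qbar) : finite_adele :=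
  FiniteAdele (coarsen_almost_integral x).

Lemma adele_of_is_zmod_morphism : zmod_morphism adele_of.
Proof.
by move=> x y; apply: finite_adeleP => p; rewrite [LHS]rmorphB.
Qed.

Lemma adele_of_is_monoid_morphism : monoid_morphism adele_of.
Proof.
split; first by apply: finite_adeleP => p; rewrite [LHS]rmorph1.
by move=> x y; apply: finite_adeleP => p; rewrite [LHS]rmorphM.
Qed.

HB.instance Definition _ := GRing.isZmodMorphism.Build Qbar
  finite_adele adele_of adele_of_is_zmod_morphism.
HB.instance Definition _ := GRing.isMonoidMorphism.Build Qbar
  finite_adele adele_of adele_of_is_monoid_morphism.

Lemma adele_of_to_completion q :
  adele_of (to_completion finite_adelic_base q) = diag q.
Proof. by apply: finite_adeleP => p; exact: coarsen_to_completion. Qed.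

(** * Comparison of the neighbourhood bases, and injectivity *)

Lemma adele_setE q x :
  adele_set q x <-> integral_adele (diag (val q)^-1 * x).
Proof.
have qV : diag (val q)^-1 * diag (val q) = 1.
  by rewrite -rmorphM mulVf ?(valP q) // rmorph1.
split=> [[y yi <-]|h]; first by rewrite mulrA qV mul1r.
exists (diag (val q)^-1 * x) => //.
by rewrite mulrA [_ * diag _^-1]mulrC qV mul1r.
Qed.

Definition e_psi_unit (k : int) : {q : rat | q != 0} :=
  exist (fun q : rat => q != 0) _ (e_psi_neq0 k).

Lemma adele_set_adele_of k x :
  adele_set (e_psi_unit k) (adele_of x) <-> completed k x.
Proof.
have [a <-] := class_of_surj x; rewrite adele_setE completed_class_of.
have compE p : (diag (e_psi k)^-1 * adele_of (class_of a)) p =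
    class_of (CauchySeq (cst_cauchy (padic_base p) (e_psi k)^-1) *
              coarsen_seq (@finite_adelic_padic p) a).
  rewrite finite_adeleME class_ofM; congr (_ * _).
  exact: coarsen_class_of.
split=> [h|[N NP] p]; last first.
  rewrite compE; apply/completed_class_of; exists N => n /NP.
  by rewrite cauchy_seqME /= padic_set0E => /finite_adelic_setE.
(* This [N] serves all primes at once, while the rank [M] below depends on [p]. Integrality at index
   [maxn N M] passes to index [n] because both are at least [N]. *)
have [N NP] := Defs.cauchyP _ _ (cauchy_seq_cauchy a) k.
exists N => n Nn; apply/finite_adelic_setE => p.
have := h p; rewrite compE => /completed_class_of[M MP].
have := MP (maxn N M) (leq_maxr _ _).
rewrite cauchy_seqME /= padic_set0E => am.
have /finite_adelic_setE/(_ p) := NP _ _ (leq_maxl N M) Nn.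
rewrite mulrBr => dam.
rewrite -(subKr ((e_psi k)^-1 * a (maxn N M)) (_ * a n)).
exact: local_intB.
Qed.

Lemma adele_of_inj : injective adele_of.
Proof.
apply: raddf_inj => x x0; apply: completed_sep => k.
by apply/adele_set_adele_of; rewrite x0; exact: adele_set0.
Qed.

(** * Density of the rationals in the finite adeles *)

Lemma local_int_mod p (q : rat) : local_int p q ->
  exists c : int, padic_set p 1 (q - c%:~R).
Proof.
move=> pq; have p_pr := valP p.
have : coprimez (denq q) (val p)%:Z.
  by rewrite coprimezE absz_nat coprime_sym prime_coprime.
move=> /coprimezP[[u v] /= uv].
(* By the Bezout relation [u * denq q + v * p = 1], [q - u * numq q = p * (q * v)]. *)
exists (u * numq q); exists (q * v%:~R).
  by apply: local_intM => //; exact: local_int_int.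
move/(congr1 (fun z : int => z%:~R : rat)): uv.
rewrite expr1z intrD !intrM mulr1z numqE -pmulrn => uv.
by rewrite -[q in q - _]mulr1 -[X in q * X - _]uv; ring.
Qed.

(** Only the component at [p] constrains [c], since [p] is a unit in [Z_l] for every other prime
    [l]. *)
Lemma integral_adele_mod (p : prime_number) (w : finite_adele) :
  integral_adele w -> exists c : int,
  integral_adele (diag (val p)%:R^-1 * (w - diag c%:~R)).
Proof.
move=> wi; have p_pr := valP p.
have [q qw] := to_completion_dense (w p) 1.
have qw0 : Defs.Zp (to_completion (padic_base p) q - w p).
  have [a aE] := class_of_surj (to_completion (padic_base p) q - w p).
  move: qw; rewrite -aE => /completed_class_of[N NP].
  by apply/completed_class_of; exists N => n /NP; exact: padic_set_le.
have /local_int_mod[c qc] : local_int p q.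
  apply/Zp_to_completion; rewrite -(subrK (w p) (to_completion _ q)).
  exact: (rbD (B := completion_base (padic_base p))) qw0 (wi p).
exists c => l; rewrite finite_adeleME finite_adeleBE !diagE.
have [->|lp] := eqVneq l p.
  (* The level 0 is split as -1 + 1: [1/p] has level -1 and [w p - c] has level 1. *)
  rewrite /Defs.Zp -(addNr (1 : int)); apply: completed_padicMD.
    apply/completed_to_completion; exists 1; first exact: (local_int_int p 1).
    by rewrite mulr1 -exprN1.
  rewrite -(subrK (to_completion _ q) (w p)) -addrA -rmorphB.
  apply: (rbD (B := completion_base (padic_base p))).
    by rewrite -opprB; exact: (rbN (B := completion_base (padic_base p))).
  by apply/completed_to_completion.
apply: ZpM; last by apply: completedB (wi l) _; exact: Zp_int.
apply/Zp_to_completion/local_intP; exists 1, (val p).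
split; last by rewrite div1r.
by rewrite absz_nat dvdn_prime2 ?(valP l).
Qed.

Lemma integral_adele_approx (x : finite_adele) :
  exists r : rat, integral_adele (x - diag r).
Proof.
have [n n0 nx] := clear_denominators x.
(* The adele varies in the induction: with [n = m * p], the hypothesis for [m] is applied to
   [p * x]. *)
elim/ltn_ind: n => n IH in x n0 nx *.
have [n1|] := leqP n 1.
  have {}n1 : n = 1%N by case: n n0 n1 {IH nx} => [|[]].
  by exists 0; move: nx; rewrite n1 rmorph0 subr0 rmorph1 mul1r.
move=> n1; pose p : prime_number :=
  exist (fun p => prime p) _ (pdiv_prime n1).
have /dvdnP[m mE] : (val p %| n)%N by exact: pdiv_dvd.
have p0 : (val p)%:R != 0 :> rat by rewrite pnatr_eq0 -lt0n prime_gt0 ?(valP p).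
have m0 : m != 0%N by apply: contraNneq n0 => m0; rewrite mE m0.
have mn : (m < n)%N by rewrite mE ltn_Pmulr ?lt0n // prime_gt1 ?(valP p).
have [|r rP] := IH m mn (diag (val p)%:R * x) m0.
  by rewrite mulrA -rmorphM -natrM -mE.
have [c cP] := integral_adele_mod p rP.
(* [c] makes [(p * x - r - c) / p] integral, and this is [x - (r + c) / p]. *)
exists ((val p)%:R^-1 * (r + c%:~R)).
have -> // : x - diag ((val p)%:R^-1 * (r + c%:~R)) =
  diag (val p)%:R^-1 * (diag (val p)%:R * x - diag r - diag c%:~R).
rewrite -addrA -opprD -rmorphD mulrBr mulrA -!rmorphM mulVf //.
by rewrite rmorph1 mul1r.
Qed.

Lemma diag_dense (x : finite_adele) q : exists r, adele_set q (x - diag r).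
Proof.
have [r rP] := integral_adele_approx (diag (val q)^-1 * x).
exists (val q * r); apply/adele_setE.
by rewrite mulrBr -rmorphM mulKf ?(valP q).
Qed.

(** * Surjectivity *)

(** Some [m_n] is a multiple of the numerator of [q], hence an integer multiple of [q]. *)
Lemma adele_set_e_psi q : exists k, adele_set (e_psi_unit k) `<=` adele_set q.
Proof.
have q0 : (0 < `|numq (val q)|)%N by rewrite absz_gt0 numq_eq0 (valP q).
have [n /dvdnP[c cE]] := dvdn_lcm_value q0.
exists (Posz n) => _ [y yi <-].
suff -> : val (e_psi_unit n) =
    val q * (denq (val q) * sgz (numq (val q)) * c)%:~R by exact: adele_set_int.
rewrite -mulrA intrM mulrA -numqE -intrM /= cE pmulrn PoszM abszEsg.
by congr (_ %:~R); ring.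
Qed.

Lemma adele_set_le (i k : int) : i <= k ->
  adele_set (e_psi_unit k) `<=` adele_set (e_psi_unit i).
Proof.
move=> /e_psi_dvd[z zE] _ [y yi <-].
by rewrite /= zE; exact: adele_set_int.
Qed.

Lemma adele_of_surj y : exists x, adele_of x = y.
Proof.
(* The preimage of [y] is the class of rationals [r k] approximating [y] to within the [k]-th basic
   neighbourhood. *)
have [r rP] := choice (fun k : nat => diag_dense y (e_psi_unit k)).
have rE i (n : nat) : (`|i| <= n)%N ->
    adele_set (e_psi_unit i) (y - diag (r n)).
  move=> ni; apply: adele_set_le (rP n).
  by apply: le_trans (ler_norm i) _; rewrite -abszE lez_nat.
have rB i n m : (`|i| <= n)%N -> (`|i| <= m)%N ->
    finite_adelic_base i (r n - r m).
  (* Closeness of rationals is tested on their diagonal images, both close to [y]. *)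
  move=> ni mi; apply/completed_to_completion/adele_set_adele_of.
  rewrite adele_of_to_completion rmorphB /= -(subrKA y) addrC.
  rewrite -[_ - y]opprB; exact: adele_setB (rE _ _ mi) (rE _ _ ni).
have rC : r \in Defs.cauchy finite_adelic_base.
  by apply/Defs.cauchyP => i; exists `|i|%N => n m ni mi; exact: rB.
pose x : Qbar := class_of (CauchySeq rC).
exists x; apply/eqP; rewrite -subr_eq0; apply/eqP/adele_set_sep => q.
have [k] := adele_set_e_psi q; apply.
rewrite -(subrKA (diag (r `|k|%N))) -[diag _ - y]opprB.
apply: adele_setB; last exact: rE.
rewrite -adele_of_to_completion -rmorphB; apply/adele_set_adele_of.
rewrite -class_ofB; apply/completed_class_of; exists `|k|%N => n nk.
exact: rB.
Qed.

(** * The inverse isomorphism and continuity in both directions *)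

Definition of_adele (y : finite_adele) : Qbar := sval (cid (adele_of_surj y)).

Lemma of_adeleK : cancel of_adele adele_of.
Proof. by move=> y; rewrite /of_adele; case: cid. Qed.

Lemma adele_ofK : cancel adele_of of_adele.
Proof. by move=> x; apply: adele_of_inj; rewrite of_adeleK. Qed.

HB.instance Definition _ := GRing.isZmodMorphism.Build finite_adele Qbar
  of_adele (can2_zmod_morphism adele_ofK of_adeleK).
HB.instance Definition _ := GRing.isMonoidMorphism.Build finite_adele Qbar
  of_adele (can2_monoid_morphism adele_ofK of_adeleK).

Lemma adele_of_continuous : continuous adele_of.
Proof.
move=> x A /adele_nbhsE[q qA]; have [k kq] := adele_set_e_psi q.
apply/completion_nbhsE; exists k => y yk; apply/qA/kq.
by rewrite /= -rmorphB; apply/adele_set_adele_of.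
Qed.

Lemma of_adele_continuous : continuous of_adele.
Proof.
move=> y A /completion_nbhsE[k kA]; apply/adele_nbhsE.
exists (e_psi_unit k) => z zk; apply: kA; apply/adele_set_adele_of.
by rewrite rmorphB /= !of_adeleK.
Qed.

Theorem proposition2p14 :
  exists (f : {rmorphism Qbar -> finite_adele})
         (g : {rmorphism finite_adele -> Qbar}),
    [/\ cancel f g, cancel g f, continuous f, continuous g &
        forall q : rat, f (to_completion finite_adelic_base q) = diag q].
Proof.
exists adele_of, of_adele; split.
- exact: adele_ofK.
- exact: of_adeleK.
- exact: adele_of_continuous.
- exact: of_adele_continuous.
- exact: adele_of_to_completion.
Qed.
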